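(* Let $\mathcal{X}$ be a Polish space with metric $d$ and its Borel $\sigma$-algebra, and let $\mathcal{P}$ and $\mathcal{P}_n$ ($n\ge 1$) be nonempty, weakly compact, convex sets of Borel probability measures on $\mathcal{X}$. Let $D=\sup_{x,y\in\mathcal{X}}d(x,y)$. If $\lim_{n\to\infty}V(\mathcal{P}_n,\mathcal{P})=0$ and $D<+\infty$, then $\lim_{n\to\infty}\mathcal{W}_1(\mathcal{P}_n,\mathcal{P})=0$.
   Context: ''Weakly compact'' means compact in the topology of weak convergence of probability measures. For probability measures $\mu,\nu$ on $\mathcal{X}$: $V(\mu,\nu)=\sup_{A}|\mu(A)-\nu(A)|$ over Borel sets $A$; $W_1(\mu,\nu)=\inf\{E[d(X,Y)]:\mathrm{law}(X)=\mu,\ \mathrm{law}(Y)=\nu\}$ (infimum over all couplings). For sets of probability measures: $V(\mathcal{P},\mathcal{Q}):=\max\left(\sup_{\mu\in\mathcal{P}}\inf_{\nu\in\mathcal{Q}}V(\mu,\nu),\ \sup_{\nu\in\mathcal{Q}}\inf_{\mu\in\mathcal{P}}V(\mu,\nu)\right)$ and $\mathcal{W}_1(\mathcal{P},\mathcal{Q}):=\max\left(\sup_{\mu\in\mathcal{P}}\inf_{\nu\in\mathcal{Q}}W_1(\mu,\nu),\ \sup_{\nu\in\mathcal{Q}}\inf_{\mu\in\mathcal{P}}W_1(\mu,\nu)\right)$. *)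

(* Defs.v *)
From HB Require Import structures.
From mathcomp Require Import all_boot all_order all_algebra.
From mathcomp Require Import all_classical all_reals all_analysis.

Set Implicit Arguments.
Unset Strict Implicit.
Unset Printing Implicit Defensive.

Import Order.TTheory GRing.Theory Num.Theory.
Import numFieldNormedType.Exports.

Local Open Scope classical_set_scope.
Local Open Scope ring_scope.

(* The base point is there only because measurable types are pointed in the
   library; a space carrying a probability measure is nonempty. *)
#[short(type="pmetricType")]
HB.structure Definition PointedMetric (R : numDomainType) :=
  {X of Metric R X & isPointed X}.

Section polish.
Context (R : realType) (X : metricType R).

(* [rho] is a complete metric on X inducing the topology of X. *)
Definition compatible_complete_metric (rho : X -> X -> R) : Prop :=
  [/\ forall x y, rho x y = 0 <-> x = y,
      forall x y, rho x y = rho y x,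
      forall x y z, rho x z <= rho x y + rho y z,
      forall (x : X) (A : set X), nbhs x A <->
        exists2 e : R, 0 < e & [set y | rho x y < e] `<=` A
    & forall u : nat -> X,
        (forall e : R, 0 < e -> exists N : nat, forall m n : nat,
          (N <= m)%N -> (N <= n)%N -> rho (u m) (u n) < e) ->
        exists l : X, u n @[n --> \oo] --> l].

(* Polish as a topological space: the given metric [mdist] on X is compatible
   with the topology but is not itself required to be complete. *)
Definition polish : Prop :=
  (exists2 D : set X, countable D & dense D) /\
  (exists rho : X -> X -> R, compatible_complete_metric rho).

Definition diameter : \bar R :=
  ereal_sup [set (mdist xy.1 xy.2)%:E | xy in [set: X * X]].

End polish.
Arguments polish {R} X.
Arguments diameter {R} X.

Section borel_probabilities.
Context (R : realType) (X : pmetricType R).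

Definition borel := g_sigma_algebraType (@open X).

Notation pr := (probability borel R).

(* Two inhabitants of [probability borel R] may differ on nonmeasurable sets
   only, where their values are meaningless; all the notions below depend on
   the values on Borel sets only. *)

Definition bounded_continuous : Type :=
  {f : X -> R | continuous f /\ bounded_fun f}.

(* The topology of weak convergence: the coarsest one that makes
   mu |-> \int f d mu continuous for each bounded continuous f. *)
Definition weak_test (mu : pr) : prod_topology (fun _ : bounded_continuous => R)
  := fun f => \int[mu]_x (sval f x).

Definition weakly_compact (P : set pr) : Prop :=
  @compact (initial_topology weak_test) P.

Definition convex_probabilities (P : set pr) : Prop :=
  forall (mu nu : pr) (t : R), P mu -> P nu -> 0 <= t <= 1 ->
    exists2 xi : pr, P xi & forall A : set borel, measurable A ->
      xi A = (t%:E * mu A + (1 - t)%:E * nu A)%E.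

Definition tv_dist (mu nu : pr) : \bar R :=
  ereal_sup [set `|mu A - nu A|%E | A in (measurable : set (set borel))].

Definition has_law d (Omega : measurableType d) (Pr : probability Omega R)
    (Z : {RV Pr >-> borel}) (mu : pr) : Prop :=
  forall A : set borel, measurable A -> distribution Pr Z A = mu A.

(* The infimum ranges over all probability spaces and all pairs of random
   variables on them with the prescribed laws. *)
Definition wasserstein1 (mu nu : pr) : \bar R :=
  ereal_inf [set e : \bar R |
    exists (d : measure_display) (Omega : measurableType d)
           (Pr : probability Omega R) (Z1 Z2 : {RV Pr >-> borel}),
      [/\ has_law Z1 mu, has_law Z2 nu
        & e = 'E_Pr[fun w => mdist (Z1 w : X) (Z2 w : X)]%E]].

Definition hausdorff_of (rho : pr -> pr -> \bar R) (P Q : set pr) : \bar R :=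
  maxe
    (ereal_sup [set ereal_inf [set rho mu nu | nu in Q] | mu in P])
    (ereal_sup [set ereal_inf [set rho mu nu | mu in P] | nu in Q]).

Definition tv_sets : set pr -> set pr -> \bar R := hausdorff_of tv_dist.

Definition wasserstein1_sets : set pr -> set pr -> \bar R :=
  hausdorff_of wasserstein1.

End borel_probabilities.

(* Main.v *)
Require Import Defs.
From HB Require Import structures.
From mathcomp Require Import all_boot all_order all_algebra.
From mathcomp Require Import all_classical all_reals all_analysis.
From mathcomp Require Import measurable_realfun.

(** The distance W_1 is dominated by total variation on a bounded space: if
    d <= c then W_1(mu, nu) <= c V(mu, nu) ([wasserstein1_le_tv]). Such a bound
    passes through infima and suprema, hence to the two Hausdorff-type
    distances between sets of probabilities ([hausdorff_of_scale]), and the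
    convergence follows by squeezing.

    The bound for two measures comes from the coupling that keeps as much mass
    as possible on the diagonal. A Hahn decomposition of mu - nu yields
    mu = kappa + a and nu = kappa + b, where kappa is the minimum of mu and nu
    and a, b are the positive and negative parts of mu - nu; the common mass v
    of a and b is mu(B) - nu(B) for the positive set B
    ([overlap_decomposition]). Putting kappa on the diagonal and adding the
    product of a and b divided by v gives a coupling ([glued_coupling]) under
    which the two coordinates differ with probability at most v, so the
    expected distance is at most c v.

    The expected distance is estimated without any appeal to measurability of
    the distance on the product space: it is the supremum of the integrals of
    the nonnegative simple functions below the distance, and each of these is
    measurable, vanishes on the diagonal and is at most c. *)

Set Implicit Arguments.
Unset Strict Implicit.
Unset Printing Implicit Defensive.

Import Order.TTheory GRing.Theory Num.Theory.
Import numFieldNormedType.Exports.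

Local Open Scope classical_set_scope.
Local Open Scope ring_scope.

(** The part kappa is nu on the positive set P of mu - nu and mu on the negative
    set N, that is, the minimum of mu and nu; the remainders are the Jordan
    parts of mu - nu, and the mass of the first one is attained as the gap
    between mu and nu at P. *)
Lemma overlap_decomposition d (T : measurableType d) (R : realType)
    (mu nu : probability T R) :
  exists (kappa : {measure set T -> \bar R})
         (a b : {finite_measure set T -> \bar R}),
    [/\ forall A, measurable A -> mu A = (kappa A + a A)%E,
        forall A, measurable A -> nu A = (kappa A + b A)%E
      & exists2 B, measurable B & a setT = `|mu B - nu B|%E].
Proof.
pose sigma : {charge set T -> \bar R} :=
  cadd (charge_of_finite_measure mu) (copp (charge_of_finite_measure nu)).
have sigmaE A : sigma A = (mu A - nu A)%E by [].
have [P [N PN]] := Hahn_decomposition sigma.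
have [[mP _] [mN _] PNT PN0] := PN.
have fmu A : measurable A -> mu A \is a fin_num by exact: fin_num_measure.
have fnu A : measurable A -> nu A \is a fin_num by exact: fin_num_measure.
have oppB (x y : \bar R) : x \is a fin_num -> y \is a fin_num ->
    (- (x - y) = y - x)%E.
  by move=> fx fy; rewrite fin_num_oppeB// addeC.
have posE A : measurable A ->
    jordan_pos PN A = (mu (A `&` P) - nu (A `&` P))%E.
  by move=> mA; rewrite jordan_posE cjordan_posE /crestr0 mem_set.
have negE A : measurable A ->
    jordan_neg PN A = (nu (A `&` N) - mu (A `&` N))%E.
  move=> mA; rewrite jordan_negE cjordan_negE /crestr0 mem_set// /crestr sigmaE.
  by apply: oppB; [apply: fmu|apply: fnu]; exact: measurableI.
have split_measure (m : probability T R) A : measurable A ->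
    m A = (m (A `&` P) + m (A `&` N))%E.
  move=> mA; rewrite -measureU//; [|exact: measurableI|exact: measurableI|].
    by rewrite -setIUr PNT setIT.
  by rewrite setIACA PN0 setI0.
exists (measure_add (mrestr nu mP) (mrestr mu mN)), (jordan_pos PN),
  (jordan_neg PN); split.
- move=> A mA; have mAP := measurableI _ _ mA mP.
  rewrite [RHS](_ : _ = (nu (A `&` P) + mu (A `&` N) +
    (mu (A `&` P) - nu (A `&` P)))%E).
    by rewrite addeC addeA subeK ?fnu// -split_measure.
  by rewrite -posE//; congr (_ + _)%E; exact: measure_addE.
- move=> A mA; have mAN := measurableI _ _ mA mN.
  rewrite [RHS](_ : _ = (nu (A `&` P) + mu (A `&` N) +
    (nu (A `&` N) - mu (A `&` N)))%E).
    by rewrite -addeA [X in (_ + X)%E]addeC subeK ?fmu// -split_measure.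
  by rewrite -negE//; congr (_ + _)%E; exact: measure_addE.
- exists P => //.
  have <- : jordan_pos PN setT = (mu P - nu P)%E by rewrite posE// setTI.
  by rewrite gee0_abs.
Qed.

(** The coupling is the image of kappa on the diagonal plus the product of the
    remainders normalised by their common mass. Only the second part charges
    pairs of distinct points and its mass is that of a, whence the bound on
    integrals of functions vanishing on the diagonal. *)
Lemma glued_coupling d (T : measurableType d) (R : realType)
    (mu nu : probability T R) (kappa : {measure set T -> \bar R})
    (a b : {finite_measure set T -> \bar R}) :
  (forall A, measurable A -> mu A = (kappa A + a A)%E) ->
  (forall A, measurable A -> nu A = (kappa A + b A)%E) ->
  exists pi : probability (T * T)%type R,
    [/\ forall A, measurable A -> pi (fst @^-1` A) = mu A,
        forall A, measurable A -> pi (snd @^-1` A) = nu A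
      & forall (h : T * T -> \bar R) (c : R),
          measurable_fun [set: T * T] h -> (forall z, 0 <= h z <= c%:E)%E ->
          (forall x, h (x, x) = (0 : \bar R)) ->
          (\int[pi]_z h z <= c%:E * a setT)%E].
Proof.
move=> mu_split nu_split.
have afin A : measurable A -> a A \is a fin_num by exact: fin_num_measure.
have bfin A : measurable A -> b A \is a fin_num by exact: fin_num_measure.
have kfin : kappa setT \is a fin_num.
  rewrite ge0_fin_numE ?measure_ge0//; apply: (@le_lt_trans _ _ (mu setT)).
    by rewrite mu_split// leeDl.
  by rewrite probability_setT ltry.
have abT : b setT = a setT.
  have : (kappa setT + b setT = kappa setT + a setT)%E.
    by rewrite -mu_split// -nu_split// !probability_setT.
  move: kfin (afin _ measurableT) (bfin _ measurableT).
  move: (kappa setT) (a setT) (b setT) => [k| |] [x| |] [y| |]//= _ _ _.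
  by rewrite -!EFinD => -[] /addrI ->.
pose v := fine (a setT).
have v0 : 0 <= v by rewrite fine_ge0.
have av : a setT = v%:E by rewrite fineK ?afin.
have le_v (m : {finite_measure set T -> \bar R}) A : measurable A ->
    m setT = v%:E -> exists2 r, m A = r%:E & 0 <= r <= v.
  move=> mA mT.
  have mfin : m A \is a fin_num by exact: fin_num_measure.
  exists (fine (m A)); first by rewrite fineK.
  by rewrite -!lee_fin fineK// measure_ge0/= -mT le_measure ?inE.
(* For v = 0 this relies on 0^-1 = 0 and forces r = 0, so that the case
   mu = nu needs no separate construction. *)
have cancel r : 0 <= r <= v -> v^-1 * (r * v) = r.
  have [->|vn0] := eqVneq v 0; last by rewrite mulrCA mulVf ?mulr1.
  by rewrite -eq_le => /eqP <-; rewrite !mulr0.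
have vV0 : 0 <= v^-1 by rewrite invr_ge0.
have mdiag : measurable_fun setT (fun x : T => (x, x)).
  exact: measurable_fun_pair.
have [diag diagE] : exists m : {measure set (T * T) -> \bar R},
    m = pushforward kappa (fun x : T => (x, x)) :> (set (T * T) -> \bar R).
  by unshelve eexists (pushforward kappa (fun x : T => (x, x))).
pose rho : {measure set (T * T) -> \bar R} := mscale (NngNum vV0) (a \x b)%E.
have rhoE A B : measurable A -> measurable B ->
    rho (A `*` B) = ((v^-1)%:E * (a A * b B))%E.
  by move=> mA mB; rewrite /rho/= /mscale/= -product_measure1E.
pose q : {measure set (T * T) -> \bar R} := measure_add diag rho.
have qE C : q C = (diag C + rho C)%E by exact: measure_addE.
have diag_fst A : diag (fst @^-1` A) = kappa A by rewrite diagE.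
have diag_snd A : diag (snd @^-1` A) = kappa A by rewrite diagE.
have q_fst A : measurable A -> q (fst @^-1` A) = mu A.
  move=> mA; rewrite qE diag_fst -setXT rhoE// abT mu_split//.
  congr (_ + _)%E.
  by have [r -> rv] := le_v a A mA av; rewrite av -!EFinM cancel.
have q_snd A : measurable A -> q (snd @^-1` A) = nu A.
  move=> mA; rewrite qE diag_snd -setTX rhoE// nu_split//.
  congr (_ + _)%E.
  have [r -> rv] := le_v b A mA (etrans abT av).
  by rewrite av -!EFinM [v * r]mulrC cancel.
have qT : q setT = 1%E.
  by rewrite -[setT]/(fst @^-1` setT) q_fst// probability_setT.
pose qP := Measure_isProbability.Build _ _ _ q qT.
pose pi : probability (T * T)%type R := HB.pack (Measure.sort q) qP.
exists pi; split => //.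
move=> h c mh h0c hdiag.
have h0 z : (0 <= h z)%E by have /andP[] := h0c z.
have -> : (\int[pi]_z h z = \int[diag]_z h z + \int[rho]_z h z)%E.
  by rewrite -ge0_integral_measure_add.
have -> : (\int[diag]_z h z = 0)%E.
  by rewrite diagE ge0_integral_pushforward//=; exact: integral0_eq.
rewrite add0e; apply: (@le_trans _ _ (\int[rho]_z cst c%:E z)%E).
  by apply: ge0_le_integral => // z _; have /andP[] := h0c z.
rewrite integral_cst// -setXTT rhoE// abT av -!EFinM cancel//.
by rewrite v0 lexx.
Qed.

Import HBNNSimple.

(** The two coordinates on the product space, under the glued coupling, are one
    of the competitors in the infimum that defines W_1; the mass bounding their
    expected distance is the gap between mu and nu at a single set, hence at
    most the total variation. *)
Lemma wasserstein1_le_tv (R : realType) (X : pmetricType R) (c : R)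
    (mu nu : probability (borel X) R) :
  (forall x y : X, mdist x y <= c) ->
  (wasserstein1 mu nu <= c%:E * tv_dist mu nu)%E.
Proof.
move=> dc.
have c0 : 0 <= c by apply: le_trans (dc point point); exact: mdist_ge0.
have [kappa [a [b [mu_split nu_split [B mB aB]]]]] :=
  overlap_decomposition mu nu.
have [pi [pi_fst pi_snd pi_le]] := glued_coupling mu_split nu_split.
apply: (@le_trans _ _ (c%:E * a setT)%E); last first.
  by rewrite aB lee_wpmul2l// ereal_sup_ubound//; exists B.
pose Z1 : {RV pi >-> borel X} := mfun_Sub (mem_set measurable_fst).
pose Z2 : {RV pi >-> borel X} := mfun_Sub (mem_set measurable_snd).
apply: ge_ereal_inf.
exists 'E_pi[fun w => mdist (Z1 w : X) (Z2 w : X)]%E.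
  by exists _, _, pi, Z1, Z2; split.
rewrite unlock ge0_integralTE; last by move=> w; rewrite lee_fin mdist_ge0.
apply: ge_ereal_sup => _ [h hd <-]; rewrite -integralT_nnsfun.
apply: pi_le => [|z|x].
- exact/measurable_EFinP.
- rewrite lee_fin fun_ge0/=; apply: le_trans (hd z) _.
  by rewrite lee_fin dc.
- apply/eqP; rewrite eq_le; apply/andP; split; last by rewrite lee_fin fun_ge0.
  by apply: le_trans (hd (x, x)) _; rewrite lee_fin /= mdistxx.
Qed.

Lemma wasserstein1_ge0 (R : realType) (X : pmetricType R)
    (mu nu : probability (borel X) R) : (0 <= wasserstein1 mu nu)%E.
Proof.
apply: le_ereal_inf_tmp => _ [d [W [pi [Z1 [Z2 [_ _ ->]]]]]].
by apply: expectation_ge0 => w; exact: mdist_ge0.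
Qed.

(** Strict positivity of c lets one divide by c, so that the comparison passes
    to infima; with c = 0 it fails for an empty set, where the infimum is +oo. *)
Lemma hausdorff_of_scale (R : realType) (X : pmetricType R) (c : R)
    (rho sigma : probability (borel X) R -> probability (borel X) R -> \bar R)
    (P Q : set (probability (borel X) R)) :
  0 < c -> (forall mu nu, rho mu nu <= c%:E * sigma mu nu)%E ->
  (hausdorff_of rho P Q <= c%:E * hausdorff_of sigma P Q)%E.
Proof.
move=> c0 rho_le.
have c0E : (0 <= c%:E)%E by rewrite lee_fin ltW.
have one_sided T (S S' : set T) (f g : T -> T -> \bar R) :
    (forall x y, f x y <= c%:E * g x y)%E ->
    (ereal_sup [set ereal_inf [set f x y | y in S'] | x in S] <=
     c%:E * ereal_sup [set ereal_inf [set g x y | y in S'] | x in S])%E.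
  move=> fg; apply: ge_ereal_sup => _ [x Sx <-].
  apply: (@le_trans _ _ (c%:E * ereal_inf [set g x y | y in S'])%E); last first.
    by apply: lee_wpmul2l => //; apply: ereal_sup_ubound; exists x.
  rewrite -lee_pdivrMl//; apply: le_ereal_inf_tmp => _ [y Sy <-].
  rewrite lee_pdivrMl//; apply: le_trans (fg x y).
  by apply: ereal_inf_lbound; exists y.
rewrite /hausdorff_of ge_max; apply/andP; split.
- apply: le_trans (one_sided _ _ _ _ _ rho_le) _.
  by rewrite lee_wpmul2l// le_max lexx.
- apply: le_trans (one_sided _ _ _ _ _ (fun nu mu => rho_le mu nu)) _.
  by rewrite lee_wpmul2l// le_max lexx orbT.
Qed.

Lemma hausdorff_of_ge0 (R : realType) (X : pmetricType R)
    (rho : probability (borel X) R -> probability (borel X) R -> \bar R)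
    (P Q : set (probability (borel X) R)) :
  (forall mu nu, 0 <= rho mu nu)%E -> Q !=set0 -> (0 <= hausdorff_of rho P Q)%E.
Proof.
move=> rho0 [nu Qnu]; rewrite /hausdorff_of le_max; apply/orP; right.
apply: le_ereal_sup_tmp; exists (ereal_inf [set rho mu nu | mu in P]).
  by exists nu.
by apply: le_ereal_inf_tmp => _ [mu _ <-].
Qed.

Lemma diameter_bound (R : realType) (X : pmetricType R) :
  (diameter X < +oo)%E -> exists2 c : R, 0 < c & forall x y : X, mdist x y <= c.
Proof.
move=> Dfin.
have le_D (x y : X) : ((mdist x y)%:E <= diameter X)%E.
  by apply: ereal_sup_ubound; exists (x, y).
have D0 : (0 <= diameter X)%E.
  by apply: le_trans (le_D point point); rewrite lee_fin mdist_ge0.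
have DE : diameter X = (fine (diameter X))%:E.
  by rewrite fineK// ge0_fin_numE.
(* The extra 1 keeps the bound positive when the space is a single point. *)
exists (fine (diameter X) + 1) => [|x y].
  by rewrite ltr_wpDl// fine_ge0.
by rewrite -lee_fin; apply: le_trans (le_D x y) _; rewrite DE lee_fin lerDl.
Qed.

Theorem theorem11 (R : realType) (X : pmetricType R)
    (P : set (probability (borel X) R))
    (P_ : nat -> set (probability (borel X) R)) :
  polish X ->
  P !=set0 -> weakly_compact P -> convex_probabilities P ->
  (forall n : nat, (1 <= n)%N ->
    [/\ P_ n !=set0, weakly_compact (P_ n) & convex_probabilities (P_ n)]) ->
  tv_sets (P_ n) P @[n --> \oo] --> 0%E ->
  (diameter X < +oo)%E ->
  wasserstein1_sets (P_ n) P @[n --> \oo] --> 0%E.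
Proof.
move=> _ P0 _ _ _ tvP /diameter_bound[c c0 dc].
apply: (@squeeze_cvge _ _ _ _ (cst 0%E) _
    (fun n => c%:E * tv_sets (P_ n) P)%E) => //; last 2 first.
- exact: cvg_cst.
- by rewrite -(mule0 c%:E); exact: cvgeZl.
apply: nearW => n; apply/andP; split.
- exact: hausdorff_of_ge0 (@wasserstein1_ge0 R X) P0.
- by apply: hausdorff_of_scale => // mu nu; exact: wasserstein1_le_tv.
Qed.
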